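(* Every stable monomial ideal $I\subset R=\mathbf{k}[x_1,\dots,x_n]$ is a Mayer-Vietoris ideal of type $B2$.
   Context: $\mathbf{k}$ is a field of characteristic $0$, $R=\mathbf{k}[x_1,\dots,x_n]$. Monomial ideals are nonzero. For a monomial $m\neq 1$ let $\max(m)$ be the largest index of a variable dividing $m$. A monomial ideal $I$ is stable if for every monomial $m\in I$ and every $i<\max(m)$ one has $x_i m/x_{\max(m)}\in I$. Mayer-Vietoris trees: a Mayer-Vietoris tree $MVT(I)$ of $I$ is a rooted binary tree whose nodes are (labelled by) monomial ideals, with root $I$. Whenever a node $J$ has minimal monomial generating set $\{m_1,\dots,m_s\}$ with $s\geq 2$, one minimal generator (the pivot monomial) is chosen, the choice being arbitrary at each node; numbering so that the pivot is $m_s$, the node $J$ has exactly two children: the left child $\tilde J=\langle m_1,\dots,m_{s-1}\rangle\cap\langle m_s\rangle=\langle \mathrm{lcm}(m_1,m_s),\dots,\mathrm{lcm}(m_{s-1},m_s)\rangle$ and the right child $J'=\langle m_1,\dots,m_{s-1}\rangle$. Nodes with a single minimal generator are leaves. Positions: the root has position $1$; left and right children of the node in position $p$ have positions $2p$ and $2p+1$. Dimensions: the root has dimension $0$; left and right children of a node of dimension $d$ have dimensions $d+1$ and $d$. A node is relevant if its position is $1$ or even. Type $B2$: for a tree $MVT(I)$ let $\widehat{\beta}_{i,a}(I)$ be the number of relevant nodes of dimension $i$ of $MVT(I)$ having $x^a$ as a minimal generator, and let $\beta_{i,a}(I)=\dim_{\mathbf{k}}\mathrm{Tor}^R_{i,a}(I,\mathbf{k})$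 be the multigraded Betti numbers of $I$. $I$ is a Mayer-Vietoris ideal of type $B2$ if there is a Mayer-Vietoris tree of $I$ with $\widehat{\beta}_{i,a}(I)=\beta_{i,a}(I)$ for all $i\in\mathbb{N}$, $a\in\mathbb{N}^n$. *)

(* Defs.v *)
From HB Require Import structures.
From mathcomp Require Import all_boot all_order all_algebra.
From mathcomp.multinomials Require Import mpoly.

Set Implicit Arguments.
Unset Strict Implicit.
Unset Printing Implicit Defensive.

Import GRing.Theory.
Local Open Scope ring_scope.

(* Ideals of k[x_1..x_n] are Prop-valued predicates on
   {mpoly k[n]}; the variables are indexed by 'I_n, in increasing order. *)

Section MonomialIdeals.
Variables (k : fieldType) (n : nat).
Implicit Types (I J : {mpoly k[n]} -> Prop) (G : seq 'X_{1..n}).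

Definition ideal_gen (S : 'X_{1..n} -> Prop) (p : {mpoly k[n]}) : Prop :=
  exists2 s : seq ({mpoly k[n]} * 'X_{1..n}),
    forall c, c \in s -> S c.2 & p = \sum_(c <- s) c.1 * 'X_[c.2].

(* The generating set is not assumed to be finite. *)
Definition monomial_ideal I : Prop :=
  (exists S : 'X_{1..n} -> Prop, forall p, I p <-> ideal_gen S p)
  /\ (exists2 p, I p & p != 0).

Definition is_max_index (m : 'X_{1..n}) (j : 'I_n) : Prop :=
  (0 < m j)%N /\ (forall l : 'I_n, (j < l)%N -> m l = 0%N).

(* As x_j divides m, the truncated difference m - U_(j) is the exponent of
   the honest quotient m / x_j. *)
Definition stable I : Prop :=
  forall (m : 'X_{1..n}) (i j : 'I_n), I 'X_[m] ->
    is_max_index m j -> (i < j)%N -> I 'X_[(m - U_(j) + U_(i))%MM].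

Definition ideal_of_seq G : {mpoly k[n]} -> Prop :=
  ideal_gen (fun u => u \in G).

Definition min_gens I G : Prop :=
  [/\ uniq G, forall p, I p <-> ideal_of_seq G p
    & forall m, m \in G -> ~ ideal_of_seq (rem m G) 'X_[m]].

End MonomialIdeals.

(* A node carries the list of minimal generators of the ideal it is labelled
   by, followed by its left and right subtrees. *)
Inductive mvtree (n : nat) : Type :=
| MVLeaf of seq 'X_{1..n}
| MVNode of seq 'X_{1..n} & mvtree n & mvtree n.

Section MayerVietorisTrees.
Variables (k : fieldType) (n : nat).

Fixpoint is_mvt (I : {mpoly k[n]} -> Prop) (T : mvtree n) : Prop :=
  match T with
  | MVLeaf G => min_gens I G /\ size G = 1%N
  | MVNode G TL TR =>
      [/\ min_gens I G, (2 <= size G)%N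
        & exists m : 'X_{1..n},
            [/\ m \in G,
                is_mvt (fun p => ideal_of_seq (rem m G) p
                                 /\ ideal_of_seq [:: m] p) TL
              & is_mvt (ideal_of_seq (rem m G)) TR]]
  end.

(* The nodes of T, as triples (position, dimension, minimal generators),
   when the root of T has position p and dimension d. *)
Fixpoint mvt_nodes (p d : nat) (T : mvtree n) :
    seq (nat * nat * seq 'X_{1..n}) :=
  match T with
  | MVLeaf G => [:: (p, d, G)]
  | MVNode G TL TR =>
      (p, d, G) :: mvt_nodes (2 * p)%N d.+1 TL ++ mvt_nodes (2 * p).+1%N d TR
  end.

Definition relevant (p : nat) : bool := (p == 1%N) || ~~ odd p.

Definition mvt_betti (T : mvtree n) (i : nat) (a : 'X_{1..n}) : nat :=
  count (fun x : nat * nat * seq 'X_{1..n} =>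
           [&& relevant x.1.1, x.1.2 == i & a \in x.2])
        (mvt_nodes 1 0 T).

End MayerVietorisTrees.

(* A sequence of maps ... -> F_1 -> F_0 -> R of free R-modules,
   F_i = R^(frank i) with the j-th basis vector in multidegree fdeg i j.
   Elements are row vectors, and matrices act on the right. *)
Record free_seq (k : fieldType) (n : nat) := FreeSeq {
  frank : nat -> nat;
  fdeg  : forall i, 'I_(frank i) -> 'X_{1..n};
  fdiff : forall i, 'M[{mpoly k[n]}]_(frank i.+1, frank i);
  faug  : 'cV[{mpoly k[n]}]_(frank 0)
}.

Section Tor.
Variables (k : fieldType) (n : nat).
Implicit Types (I : {mpoly k[n]} -> Prop) (F : free_seq k n).

Definition homogeneous F : Prop :=
  (forall i (j : 'I_(frank F i.+1)) (l : 'I_(frank F i)) u,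
      u \in msupp (fdiff F i j l) -> (u + fdeg l)%MM = fdeg j)
  /\ (forall (j : 'I_(frank F 0)) u,
      u \in msupp (faug F j 0) -> u = fdeg j).

Definition graded_free_resolution I F : Prop :=
  [/\ homogeneous F,
      forall p, I p <-> exists v : 'rV_(frank F 0), v *m faug F = p%:M,
      forall v : 'rV_(frank F 0),
        v *m faug F = 0 <-> exists w : 'rV_(frank F 1), v = w *m fdiff F 0
    & forall i (v : 'rV_(frank F i.+1)),
        v *m fdiff F i = 0 <->
        exists w : 'rV_(frank F i.+2), v = w *m fdiff F i.+1].

(* The complex F (x)_R k, where k = R/(x_1..x_n): tensoring with k replaces
   each entry of the matrices by its constant term. *)
Definition diff_k F i : 'M[k]_(frank F i.+1, frank F i) :=
  map_mx (mcoeff 0%MM) (fdiff F i).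

Definition cycles_k F i : 'M[k]_(frank F i) :=
  match i return 'M[k]_(frank F i) with
  | 0 => 1%:M
  | i'.+1 => kermx (diff_k F i')
  end.

(* Row space: the multidegree a component of F_i (x)_R k. *)
Definition strand F i (a : 'X_{1..n}) : 'M[k]_(frank F i) :=
  diag_mx (\row_j (fdeg j == a)%:R).

(* dim_k H_i(F (x)_R k)_a, i.e. cycles modulo boundaries in multidegree a. *)
Definition tor_dim F i (a : 'X_{1..n}) : nat :=
  (\rank (cycles_k F i :&: strand F i a)%MS
   - \rank (strand F i.+1 a *m diff_k F i))%N.

(* dim_k Tor^R_{i,a}(I, k) = b; the value does not depend on the multigraded
   free resolution used to compute Tor. *)
Definition betti I i (a : 'X_{1..n}) (b : nat) : Prop :=
  exists2 F, graded_free_resolution I F & tor_dim F i a = b.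

Definition MV_type_B2 I : Prop :=
  exists2 T : mvtree n, is_mvt I T &
    forall i (a : 'X_{1..n}), betti I i a (mvt_betti T i a).

End Tor.

(* Main.v *)
Require Import Defs.
From mathcomp Require Import all_boot all_order all_algebra.
From mathcomp.multinomials Require Import mpoly.
From Stdlib Require Import Classical IndefiniteDescription.
From mathcomp Require Import zify.

Set Implicit Arguments.
Unset Strict Implicit.
Unset Printing Implicit Defensive.

Import GRing.Theory.
Local Open Scope ring_scope.

(** A Mayer-Vietoris tree of any monomial ideal supports a multigraded free
    resolution. If [m] is the pivot of a node and [J] the ideal of the other
    generators, then [J + (m)] is resolved by the mapping cone of a comparison
    map from the resolution of [J \cap (m)] (the left child) to that of [J] (the
    right child); the cone has the basis vectors of the right child, those of the
    left child one homological degree higher, and one more for the pivot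
    ([pivot_resolution]). By induction on the tree, the degrees of the basis
    vectors are counted by the relevant nodes ([mvt_resolution]). So the tree
    computes the Betti numbers as soon as the resolution is minimal, and for that
    it suffices that at each node the two children have no common degree in the
    same dimension ([no_cancellation_type_B2]).

    For a stable ideal, take as pivot a minimal generator [m] of maximal degree
    and, within that degree, last in a reverse lexicographic sense. Stability
    then gives that the colon ideal [J : m] is generated by the variables
    preceding the last variable of [m] ([pivot_exceeded], [pivot_covered]) and
    that [J] is again stable ([stable_gens_rem]), so that the construction can
    be repeated along the right spine. The left child is [m] times an ideal
    of variables; its tree has Koszul type and is concentrated in degree
    [mdeg m + i + 1] in dimension [i] ([koszul_tree]). The generators of [J]
    have degree at most [mdeg m], so the right subtree stays in degrees at most
    [mdeg m + i]. Hence nothing cancels, and the resolution obtained, which has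
    the shape of the Eliahou-Kervaire resolution, is minimal.

    The finiteness of the set of minimal generators is Dickson's lemma
    ([dickson]). *)

(** * Monomial ideals and their minimal generators *)

Section MonomialIdealTheory.
Variables (k : fieldType) (n : nat).
Implicit Types (G H : seq 'X_{1..n}) (u v m g h : 'X_{1..n}).
Implicit Types (p q : {mpoly k[n]}).

Lemma lepm_anti g h : (g <= h)%MM -> (h <= g)%MM -> g = h.
Proof.
by move=> gh hg; apply/mnmP=> i; apply/eqP; rewrite eqn_leq (mnm_lepP gh) (mnm_lepP hg).
Qed.

(** Turns membership in a monomial ideal into a statement about exponents, so
    that everything about generators and intersections becomes a question of
    divisibility between monomials. *)
Lemma ideal_genP (S : 'X_{1..n} -> Prop) p :
  ideal_gen S p <-> forall u, u \in msupp p -> exists2 g, S g & (g <= u)%MM.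
Proof.
split=> [[s Ss ->] u | Hp].
  elim: s Ss => [|c s IHs] Ss; first by rewrite big_nil msupp0.
  rewrite big_cons => /msuppD_le; rewrite mem_cat => /orP[|/IHs]; last first.
    by apply=> c' c's; apply: Ss; rewrite inE c's orbT.
  rewrite (perm_mem (msuppMX _ _)) => /mapP[v _ ->].
  by exists c.2; [apply: Ss; rewrite inE eqxx | apply: lem_addr].
have [s Ss Es] : exists2 s : seq ({mpoly k[n]} * 'X_{1..n}),
    forall c, c \in s -> S c.2 &
    \sum_(u <- msupp p) p@_u *: 'X_[u] = \sum_(c <- s) c.1 * 'X_[c.2].
  elim: (msupp p) Hp => [|u s IHs] Hp.
    by exists [::] => //; rewrite !big_nil.
  have [g Sg gu] := Hp u (mem_head _ _).
  have [|t St Et] := IHs; first by move=> v vs; apply: Hp; rewrite inE vs orbT.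
  exists ((p@_u *: 'X_[u - g], g) :: t) => [c|].
    by rewrite inE => /predU1P[->|/St].
  by rewrite !big_cons Et /= -scalerAl -mpolyXD submK.
by exists s; rewrite // -Es -mpolyE.
Qed.

Lemma ideal_of_seqP G p :
  ideal_of_seq G p <-> {in msupp p, forall u, has (fun g => (g <= u)%MM) G}.
Proof.
rewrite /ideal_of_seq ideal_genP; split=> Hp u up.
  by have [g Gg gu] := Hp u up; apply/hasP; exists g.
by have /hasP[g] := Hp u up; exists g.
Qed.

Lemma ideal_of_seqX G u :
  ideal_of_seq G ('X_[u] : {mpoly k[n]}) <-> has (fun g => (g <= u)%MM) G.
Proof.
rewrite ideal_of_seqP; split=> [|Gu v]; first by apply; rewrite msuppX mem_head.
by rewrite msuppX inE => /eqP ->.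
Qed.

Lemma ideal_of_seq_sub G H :
  (forall g, g \in G -> has (fun h => (h <= g)%MM) H) ->
  forall p, ideal_of_seq G p -> ideal_of_seq H p.
Proof.
move=> GH p; rewrite !ideal_of_seqP => Gp u /Gp /hasP[g /GH /hasP[h Hh hg] gu].
by apply/hasP; exists h => //; apply: lepm_trans hg gu.
Qed.

Lemma ideal_of_seqI G m p :
  ideal_of_seq G p /\ ideal_of_seq [:: m] p <->
  ideal_of_seq (map (fun g => mlcm g m) G) p.
Proof.
rewrite !ideal_of_seqP; split=> [[Gp mp] u up | Hp].
  have /hasP[g Gg gu] := Gp u up; have := mp u up; rewrite /= orbF => mu.
  apply/hasP; exists (mlcm g m).
    by apply/mapP; exists g.
  by rewrite lem_mlcm gu mu.
split=> u up; have /hasP[v /mapP[g Gg ->]] := Hp u up; rewrite lem_mlcm.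
  by case/andP=> gu _; apply/hasP; exists g.
by case/andP=> _ mu; rewrite /= mu.
Qed.

(** The form in which adding the pivot enters the mapping cone: [q] is the
    coordinate on the new basis vector. *)
Lemma ideal_of_seq_cons m G p :
  ideal_of_seq (m :: G) p <->
  exists q, ideal_of_seq G (p - q * 'X_[m]).
Proof.
rewrite {1}/ideal_of_seq; split=> [|[q [s sG E]]].
  case=> s sG ->; elim: s sG => [|c s IHs] sG.
    by exists 0; rewrite big_nil mul0r subrr; exists [::]; rewrite ?big_nil.
  have [|q [t tG Et]] := IHs; first by move=> d ds; apply: sG; rewrite inE ds orbT.
  have := sG c (mem_head _ _); rewrite inE => /predU1P[Ec|cG].
    exists (c.1 + q); exists t => //.
    by rewrite -Et big_cons Ec mulrDl opprD addrACA subrr add0r.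
  exists q; exists (c :: t) => [d|]; first by rewrite inE => /predU1P[->|/tG].
  by rewrite !big_cons -Et addrA.
exists ((q, m) :: s) => [c|]; last by rewrite big_cons -E /= addrC subrK.
by rewrite inE => /predU1P[->|/sG cG]; rewrite /= inE ?eqxx ?cG ?orbT.
Qed.

Definition antichain G :=
  all (fun g => all (fun h => (h <= g)%MM ==> (h == g)) G) G.

Lemma antichainP G :
  reflect {in G &, forall h g, (h <= g)%MM -> h = g} (antichain G).
Proof.
apply: (iffP allP) => [GG h g hG gG hg | GG g gG].
  by have /allP/(_ h hG)/implyP/(_ hg)/eqP := GG g gG.
by apply/allP=> h hG; apply/implyP=> hg; apply/eqP/GG.
Qed.

Lemma min_gensP (I : {mpoly k[n]} -> Prop) G :
  min_gens I G <->
  [/\ uniq G, forall p, I p <-> ideal_of_seq G p & antichain G].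
Proof.
split=> [[uG IG mG] | [uG IG /antichainP aG]]; split=> //.
  apply/antichainP=> h g hG gG hg; case: (eqVneq h g) => // nhg.
  case: (mG g gG); apply/ideal_of_seqX/hasP; exists h => //.
  by rewrite mem_rem_uniq // !inE nhg.
move=> m mG /ideal_of_seqX/hasP[h]; rewrite mem_rem_uniq // inE => /andP[nhm hG] hm.
by rewrite (aG h m) ?eqxx in nhm.
Qed.

Lemma min_gens_ext (I J : {mpoly k[n]} -> Prop) G :
  (forall p, I p <-> J p) -> min_gens I G -> min_gens J G.
Proof. by move=> IJ [uG IG mG]; split=> // p; rewrite -IJ. Qed.

Lemma min_gens_rem (I : {mpoly k[n]} -> Prop) m G :
  min_gens I G -> min_gens (ideal_of_seq (rem m G) : {mpoly k[n]} -> Prop) (rem m G).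
Proof.
case/min_gensP=> uG _ /antichainP aG; apply/min_gensP; split; rewrite ?rem_uniq //.
by apply/antichainP=> h g /mem_rem hG /mem_rem gG; apply: aG.
Qed.

Lemma min_gens_unique (I : {mpoly k[n]} -> Prop) G H :
  min_gens I G -> min_gens I H -> G =i H.
Proof.
have sub G1 G2 : min_gens I G1 -> min_gens I G2 -> {subset G1 <= G2}.
  move=> /min_gensP[_ I1 /antichainP a1] /min_gensP[_ I2 _] g gG1.
  have /I1/I2/ideal_of_seqX/hasP[h hG2 hg] : ideal_of_seq G1 ('X_[g] : {mpoly k[n]}).
    by apply/ideal_of_seqX/hasP; exists g => //; apply: lepm_refl.
  have /I2/I1/ideal_of_seqX/hasP[g' gG1' g'h] : ideal_of_seq G2 ('X_[h] : {mpoly k[n]}).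
    by apply/ideal_of_seqX/hasP; exists h => //; apply: lepm_refl.
  have E := a1 _ _ gG1' gG1 (lepm_trans g'h hg).
  by rewrite (@lepm_anti g h) // -E.
by move=> mG mH u; apply/idP/idP; apply: sub.
Qed.

Lemma is_mvt_ext (I J : {mpoly k[n]} -> Prop) T :
  (forall p, I p <-> J p) -> is_mvt I T -> is_mvt J T.
Proof.
case: T => [G|G TL TR] IJ /=; first by case=> mG sG; split=> //; apply: min_gens_ext mG.
by case=> mG sG H; split=> //; apply: min_gens_ext mG.
Qed.

(** Dickson's lemma by induction on the number [r] of coordinates compared: if
    the finite set [G0] covers [S] on the first [r] of them, an element that
    [G0] fails to cover on [r.+1] has its coordinate [r] below the maximum over
    [G0], so it lies in one of finitely many slices of [S], each covered by
    induction. *)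
Lemma dickson_prefix r (S : 'X_{1..n} -> Prop) : (r <= n)%N ->
  exists2 G : seq 'X_{1..n}, forall g, g \in G -> S g &
    forall u, S u -> exists2 g, g \in G & forall i : 'I_n, (i < r)%N -> (g i <= u i)%N.
Proof.
elim: r S => [|r IHr] S le_rn.
  case: (classic (exists u, S u)) => [[u0 Su0] | nS].
    by exists [:: u0] => [g|u _]; [rewrite inE => /eqP-> | exists u0; rewrite ?inE].
  by exists [::] => // u Su; case: nS; exists u.
pose x := Ordinal le_rn.
have IH (S' : 'X_{1..n} -> Prop) := IHr S' (ltnW le_rn).
have [G0 SG0 G0P] := IH S.
have cover B : exists2 G : seq 'X_{1..n}, forall g, g \in G -> S g &
    forall u, S u -> (u x < B)%N -> exists2 g, g \in G &
      forall i : 'I_n, (i < r.+1)%N -> (g i <= u i)%N.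
  elim: B => [|B [G SG GP]]; first by exists [::].
  have [GB SGB GBP] := IH (fun u => S u /\ u x = B).
  exists (GB ++ G) => [g|u Su]; first by rewrite mem_cat => /orP[/SGB[]|/SG].
  rewrite ltnS leq_eqVlt => /predU1P[uB | /(GP u Su)[g gG gu]]; last first.
    by exists g; rewrite // mem_cat gG orbT.
  have [g gGB gu] := GBP u (conj Su uB).
  exists g; rewrite ?mem_cat ?gGB // => i; rewrite ltnS leq_eqVlt => /predU1P[ir|/gu//].
  have -> : i = x by apply: val_inj.
  by rewrite uB (SGB g gGB).2.
have [G SG GP] := cover (\max_(g <- G0) g x)%N.
exists (G0 ++ G) => [g|u Su]; first by rewrite mem_cat => /orP[/SG0|/SG].
have [g gG0 gu] := G0P u Su.
case: (leqP (g x) (u x)) => [gux | ugx].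
  exists g; rewrite ?mem_cat ?gG0 // => i; rewrite ltnS leq_eqVlt => /predU1P[ir|/gu//].
  by have -> : i = x by apply: val_inj.
have [|g' gG gu'] := GP u Su; last by exists g'; rewrite // mem_cat gG orbT.
by apply: leq_trans ugx _; rewrite (big_rem g) //= leq_maxl.
Qed.

Lemma dickson (S : 'X_{1..n} -> Prop) :
  exists2 G : seq 'X_{1..n}, forall g, g \in G -> S g &
    forall u, S u -> exists2 g, g \in G & (g <= u)%MM.
Proof.
have [G SG GP] := dickson_prefix S (leqnn n).
exists G => // u /GP[g gG gu]; exists g => //.
by apply/mnm_lepP=> i; apply: gu.
Qed.

Lemma antichain_refine G : exists2 H : seq 'X_{1..n}, uniq H /\ antichain H &
  {subset H <= G} /\ forall g, g \in G -> has (fun h => (h <= g)%MM) H.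
Proof.
pose H := [seq g <- undup G | all (fun h => (h <= g)%MM ==> (h == g)) G].
exists H; split; first by rewrite filter_uniq ?undup_uniq.
- apply/antichainP=> h g; rewrite !mem_filter !mem_undup.
  move=> /andP[_ hG] /andP[/allP gmin _] hg.
  by apply/eqP; apply: implyP hg; apply: gmin.
- by move=> g; rewrite mem_filter mem_undup => /andP[].
move=> g; have [d] := ubnP (mdeg g); elim: d g => // d IHd g le_d gG.
case gmin: (all (fun h => (h <= g)%MM ==> (h == g)) G).
  by apply/hasP; exists g; rewrite ?mem_filter ?gmin ?mem_undup // lepm_refl.
have /allPn[h hG] := negbT gmin; rewrite negb_imply => /andP[hg nhg].
have dhg : (mdeg h < mdeg g)%N.
  rewrite -(submK hg) mdegD -[X in (X < _)%N]add0n ltn_add2r lt0n mdeg_eq0.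
  by apply: contraNneq nhg => E; rewrite -(submK hg) E add0m.
have /hasP[h' h'H h'h] := IHd h (leq_trans dhg le_d) hG.
by apply/hasP; exists h' => //; apply: lepm_trans h'h hg.
Qed.

Lemma monomial_ideal_min_gens (I : {mpoly k[n]} -> Prop) :
  monomial_ideal I -> exists2 G, min_gens I G & (0 < size G)%N.
Proof.
case=> -[S IS] [p Ip nz_p].
have [G0 SG0 G0P] := dickson S.
have [G [uG aG] [GG0 G0G]] := antichain_refine G0.
have IG q : I q <-> ideal_of_seq G q.
  rewrite IS ideal_genP ideal_of_seqP; split=> Hq u uq.
    have [s /G0P[g gG0 gs] su] := Hq u uq.
    have /hasP[h hG hg] := G0G g gG0.
    by apply/hasP; exists h; rewrite // (lepm_trans hg) // (lepm_trans gs).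
  have /hasP[g gG gu] := Hq u uq.
  by exists g => //; apply/SG0/GG0.
exists G; first by apply/min_gensP.
case: G IG {uG aG GG0 G0G} => // IG; case/eqP: nz_p.
have [s sG ->] := (IG p).1 Ip.
by case: s sG => [|c s /(_ c (mem_head _ _))//]; rewrite big_nil.
Qed.

End MonomialIdealTheory.

(** * Homogeneous matrices over the polynomial ring *)

Section HomogeneousMatrices.
Variables (k : fieldType) (n : nat).
Local Notation R := {mpoly k[n]}.
Implicit Types (a d e u w : 'X_{1..n}) (p q : R).

Definition homogmx r s (e : 'I_r -> 'X_{1..n}) (d : 'I_s -> 'X_{1..n})
    (A : 'M[R]_(r, s)) :=
  forall i j u, u \in msupp (A i j) -> (u + d j)%MM = e i.

(** The coefficient that a basis vector of degree [d] has in the component of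
    degree [a] of a vector, when its coefficient in that vector is [p]. *)
Definition hpart a d p : R := if (d <= a)%MM then p@_(a - d) *: 'X_[a - d] else 0.

Lemma mcoeff_hpart a d p u : (hpart a d p)@_u = if (u + d)%MM == a then p@_u else 0.
Proof.
rewrite /hpart; case: ifP => [da | /negP nda]; last first.
  by rewrite mcoeff0; case: eqP => // E; case: nda; rewrite -E lem_addl.
rewrite mcoeffZ mcoeffX; have -> : ((a - d)%MM == u) = ((u + d)%MM == a).
  by rewrite -(eqm_add2r d) submK // eq_sym.
case: eqP => [<-|_]; last by rewrite mulr0.
by rewrite addmK mulr1.
Qed.

Lemma hpart_sum a d (I : Type) (r : seq I) (P : pred I) (f : I -> R) :
  hpart a d (\sum_(i <- r | P i) f i) = \sum_(i <- r | P i) hpart a d (f i).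
Proof.
apply/mpolyP => u; rewrite mcoeff_hpart !raddf_sum /=.
by under [RHS]eq_bigr do rewrite mcoeff_hpart; case: eqP => // _; rewrite big1.
Qed.

Lemma hpart_id a d p : {in msupp p, forall u, (u + d)%MM = a} -> hpart a d p = p.
Proof.
move=> hp; apply/mpolyP=> u; rewrite mcoeff_hpart; case: eqP => // ne.
by apply/esym/memN_msupp_eq0/negP=> /hp.
Qed.

Lemma hpartMX a d w p : hpart a d (p * 'X_[w]) = hpart a (w + d) p * 'X_[w].
Proof.
apply/mpolyP=> u; rewrite mcoeff_hpart.
case wu: (w <= u)%MM.
  rewrite -(submK wu) [(u - w + w)%MM]addmC !mcoeffMX mcoeff_hpart.
  by rewrite -addmA addmC -addmA [(d + w)%MM]addmC.
have nw q : (q * 'X_[w])@_u = 0.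
  apply/memN_msupp_eq0; rewrite (perm_mem (msuppMX _ _)).
  by apply/mapP=> -[v _ E]; rewrite E lem_addr in wu.
by rewrite !nw if_same.
Qed.

Lemma hpartM a d e p q : {in msupp q, forall u, (u + d)%MM = e} ->
  hpart a d (p * q) = hpart a e p * q.
Proof.
move=> hq; rewrite (mpolyE q) !mulr_sumr hpart_sum; apply: eq_big_seq => w wq.
rewrite -!mul_mpolyC !(mulrCA p) !(mulrCA (hpart a e p)) -(hq w wq) -hpartMX.
rewrite !mul_mpolyC; apply/mpolyP=> u; rewrite mcoeffZ !mcoeff_hpart mcoeffZ.
by case: eqP; rewrite ?mulr0.
Qed.

Lemma hpart_supp a d p : {in msupp (hpart a d p), forall u, (u + d)%MM = a}.
Proof.
by move=> u; rewrite mcoeff_msupp mcoeff_hpart; case: (_ =P a) => // _; rewrite eqxx.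
Qed.

Lemma homogmx_mul r s t (e : 'I_r -> 'X_{1..n}) (d : 'I_s -> 'X_{1..n})
    (c : 'I_t -> 'X_{1..n}) (A : 'M[R]_(r, s)) (B : 'M[R]_(s, t)) :
  homogmx e d A -> homogmx d c B -> homogmx e c (A *m B).
Proof.
move=> hA hB i l u; rewrite mxE => /msupp_sum_le/flattenP[/= s' /mapP[j _ ->]].
move=> /msuppM_le/allpairsP[[v w] /= [vA wB ->]].
by rewrite -(hA i j v vA) -(hB j l w wB) addmA.
Qed.

(** A homogeneous system that is solvable over the ring is solvable in the
    right degrees: discard from a solution of each row all but its component of
    the degree of that row. *)
Lemma homogmx_lift r s t (e : 'I_r -> 'X_{1..n}) (d : 'I_s -> 'X_{1..n})
    (c : 'I_t -> 'X_{1..n}) (A : 'M[R]_(r, s)) (B : 'M[R]_(t, s)) :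
  homogmx e d A -> homogmx c d B ->
  (forall i, exists v, v *m A = row i B) ->
  exists2 W, homogmx c e W & W *m A = B.
Proof.
move=> hA hB /fin_all_exists[f fP].
exists (\matrix_(i, j) hpart (c i) (e j) (f i 0 j)) => [i j u|].
  by rewrite mxE => /hpart_supp.
apply/matrixP=> i l; rewrite mxE.
have /(congr1 (hpart (c i) (d l))) := congr1 (fun M : 'rV_s => M 0 l) (fP i).
rewrite mxE hpart_sum mxE.
rewrite (hpart_id (hB i l)) => <-; apply: eq_bigr => j _.
by rewrite mxE (hpartM _ _ (hA j l)).
Qed.

End HomogeneousMatrices.

(** * Mapping cones *)

Lemma dependent_choice (T : nat -> Type) (P : forall i, T i -> Prop)
    (Q : forall i, T i -> T i.+1 -> Prop) :
  (exists x, P 0%N x) ->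
  (forall i x, P i x -> exists2 y, P i.+1 y & Q i x y) ->
  exists f : forall i, T i, forall i, P i (f i) /\ Q i (f i) (f i.+1).
Proof.
case=> x0 P0 step.
have next i (s : {x | P i x}) : {s' : {y | P i.+1 y} | Q i (sval s) (sval s')}.
  apply: constructive_indefinite_description.
  by case: s => x Px; have [y Py Qy] := step i x Px; exists (exist _ y Py).
pose f := fix f i : {x | P i x} :=
  if i is i'.+1 then sval (next i' (f i')) else exist _ x0 P0.
exists (fun i => sval (f i)) => i; split; first exact: (svalP (f i)).
exact: (svalP (next i (f i))).
Qed.

Section MappingCone.
Variables (k : fieldType) (n : nat).
Local Notation R := {mpoly k[n]}.
Implicit Types (F K C : free_seq k n) (I J : R -> Prop).

(** Exactness of a mapping cone at one spot. If the second coordinate [w] is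
    [y *m D], subtracting the boundary of [- y] leaves a first coordinate that
    is a cycle, hence a boundary. [P] is the condition for [w] to be a boundary;
    at the tail of the cone it is not the vanishing of a differential. *)
Lemma cone_exact p' p q r' r (A : 'M[R]_(p', p)) (B : 'M[R]_(p, q))
    (phi : 'M[R]_(r', p)) (D : 'M[R]_(r', r)) (psi : 'M[R]_(r, q))
    (P : 'rV[R]_r -> Prop) :
  (forall v : 'rV_p, v *m B = 0 <-> exists w : 'rV_p', v = w *m A) ->
  phi *m B = D *m psi ->
  (forall w, P w <-> exists y : 'rV_r', w = y *m D) ->
  forall v w, (v *m B + w *m psi = 0 /\ P w) <->
    exists z : 'rV_(p' + r'), row_mx v w = z *m block_mx A 0 phi (- D).
Proof.
move=> exA comm exD v w; split=> [[E /exD[y Ew]] | [z]].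
  have /exA[x Ex] : (v + y *m phi) *m B = 0.
    by rewrite mulmxDl -mulmxA comm mulmxA -Ew.
  exists (row_mx x (- y)); rewrite mul_row_block mulmx0 add0r !mulNmx mulmxN opprK.
  by rewrite -Ew -Ex addrK.
rewrite -[z]hsubmxK mul_row_block mulmx0 add0r mulmxN -mulNmx.
move: (lsubmx z) (rsubmx z) => x y /eq_row_mx[-> ->]; split; last first.
  by apply/exD; exists (- y).
have xA : x *m A *m B = 0 by apply/exA; exists x.
by rewrite mulmxDl xA add0r -[y *m phi *m B]mulmxA comm mulNmx mulmxA mulNmx subrr.
Qed.

(** For a minimal resolution this is the multigraded Betti number, see
    [minimal_tor_dim]. *)
Definition ndeg F i (a : 'X_{1..n}) : nat := (\sum_(j < frank F i) (fdeg j == a))%N.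

Lemma homogeneousP F : homogeneous F <->
  (forall i, homogmx (@fdeg _ _ F i.+1) (@fdeg _ _ F i) (fdiff F i)) /\
  homogmx (@fdeg _ _ F 0%N) (fun=> 0%MM) (faug F).
Proof.
split=> -[hd ha]; split=> [i j l u|].
- exact: hd.
- by move=> j l u; rewrite (ord1 l) addm0; apply: ha.
- exact: hd.
by move=> j u ul; rewrite -(ha _ _ _ ul) addm0.
Qed.

(** The comparison theorem of homological algebra, one step off: [phi i] sends
    [K_(i+1)] to [F_i], so that it can serve as the connecting part of a cone.
    Each step is an application of [homogmx_lift], the exactness of [F] making
    the system solvable. *)
Lemma comparison_map J F K : graded_free_resolution J F -> homogeneous K ->
  (forall v : 'rV_(frank K 0),
     (exists w, v = w *m fdiff K 0) -> J ((v *m faug K) 0 0)) ->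
  (forall i (v : 'rV_(frank K i.+1)),
     (exists w, v = w *m fdiff K i.+1) -> v *m fdiff K i = 0) ->
  exists phi : forall i, 'M[R]_(frank K i.+1, frank F i),
    [/\ forall i, homogmx (@fdeg _ _ K i.+1) (@fdeg _ _ F i) (phi i),
        phi 0%N *m faug F = fdiff K 0 *m faug K
      & forall i, phi i.+1 *m fdiff F i = fdiff K i.+1 *m phi i].
Proof.
case=> /homogeneousP[hF haF] JF exF0 exF /homogeneousP[hK haK] JK cK.
have DD i : fdiff K i.+1 *m fdiff K i = 0.
  apply/row_matrixP=> j; rewrite row_mul row0; apply: cK.
  by exists (delta_mx 0 j); rewrite rowE.
have [phi0 hphi0 Ephi0] : exists2 phi0 : 'M_(frank K 1, frank F 0),
    homogmx (@fdeg _ _ K 1%N) (@fdeg _ _ F 0%N) phi0 &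
    phi0 *m faug F = fdiff K 0 *m faug K.
  apply: (homogmx_lift haF) (homogmx_mul (hK 0%N) haK) _ => j.
  rewrite row_mul; have [|v Ev] := (JF ((row j (fdiff K 0) *m faug K) 0 0)).1.
    by apply: JK; exists (delta_mx 0 j); rewrite rowE.
  by exists v; rewrite Ev -mx11_scalar.
(* Besides homogeneity, [P] says what the next lifting step needs: [phi] is
   compatible with the previous differential. *)
pose P i (phi : 'M[R]_(frank K i.+1, frank F i)) :=
  homogmx (@fdeg _ _ K i.+1) (@fdeg _ _ F i) phi /\
  match i return 'M[R]_(frank K i.+1, frank F i) -> Prop with
  | 0 => fun phi => phi *m faug F = fdiff K 0 *m faug K
  | i'.+1 => fun phi => fdiff K i'.+2 *m phi *m fdiff F i' = 0
  end phi.
pose Q i (x : 'M[R]_(frank K i.+1, frank F i))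
    (y : 'M[R]_(frank K i.+2, frank F i.+1)) :=
  y *m fdiff F i = fdiff K i.+1 *m x.
have [||phi phiP] := @dependent_choice _ P Q.
- by exists phi0; split.
- move=> i x [hx Px].
  have [|y hy Ey] := homogmx_lift (hF i) (homogmx_mul (hK i.+1) hx).
    move=> j; rewrite row_mul; case: i x hx Px j => [|i] x hx Px j.
      have [|w ->] := (exF0 (row j (fdiff K 1) *m x)).1; last by exists w.
      by rewrite -mulmxA Px mulmxA -row_mul DD row0 mul0mx.
    have [|w ->] := (exF i (row j (fdiff K i.+2) *m x)).1; last by exists w.
    by rewrite -row_mul -row_mul Px row0.
  exists y => //; split=> //=.
  by rewrite -mulmxA Ey mulmxA DD mul0mx.
exists phi; split=> [i||i]; first by have [[]] := phiP i.
  by have [[]] := phiP 0%N.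
by have [] := phiP i.
Qed.

Definition cone F K (phi : forall i, 'M[R]_(frank K i.+1, frank F i)) :
    free_seq k n :=
  @FreeSeq k n (fun i => frank F i + frank K i)%N
    (fun i j => match split j with inl l => fdeg l | inr l => fdeg l end)
    (fun i => block_mx (fdiff F i) 0 (phi i) (- fdiff K i))
    (col_mx (faug F) (faug K)).

Lemma ndeg_cone F K phi i a : ndeg (@cone F K phi) i a = (ndeg F i a + ndeg K i a)%N.
Proof.
rewrite /ndeg big_split_ord; congr (_ + _)%N; apply: eq_bigr => j _ /=.
  by rewrite (unsplitK (inl j)).
by rewrite (unsplitK (inr j)).
Qed.

(** [K] resolves the quotient of [K_0] by the vectors that its augmentation
    sends into [J]; adjoining [K_0] to [F_0] as new generators, with their
    relations modulo [J], resolves the larger ideal. *)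
Lemma cone_resolution I J F K phi :
  graded_free_resolution J F -> homogeneous K ->
  (forall v : 'rV_(frank K 0),
     J ((v *m faug K) 0 0) <-> exists w, v = w *m fdiff K 0) ->
  (forall i (v : 'rV_(frank K i.+1)),
     v *m fdiff K i = 0 <-> exists w, v = w *m fdiff K i.+1) ->
  (forall p, I p <-> exists v : 'rV_(frank K 0), J (p - (v *m faug K) 0 0)) ->
  (forall i, homogmx (@fdeg _ _ K i.+1) (@fdeg _ _ F i) (phi i)) ->
  phi 0%N *m faug F = fdiff K 0 *m faug K ->
  (forall i, phi i.+1 *m fdiff F i = fdiff K i.+1 *m phi i) ->
  graded_free_resolution I (@cone F K phi).
Proof.
case=> /homogeneousP[hF haF] JF exF0 exF /homogeneousP[hK haK] JK exK IJ hphi phi0 phiS.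
split.
- apply/homogeneousP; split=> [i j l u | j l u] /=.
    rewrite !mxE; case: (split j) => j'; rewrite mxE; case: (split l) => l'.
    + exact: hF.
    + by rewrite mxE msupp0.
    + exact: hphi.
    + by rewrite mxE (perm_mem (msuppN _)); apply: hK.
  by rewrite mxE; case: (split j) => j'; [apply: haF | apply: haK].
- move=> p; rewrite IJ; split=> [[w /JF[v Ev]] | [v]].
    exists (row_mx v w); rewrite /= mul_row_col Ev.
    by rewrite [X in _ + X]mx11_scalar -(raddfD (@scalar_mx R 1)) subrK.
  rewrite -[v](@hsubmxK _ _ (frank F 0) (frank K 0)) /= mul_row_col.
  move: (lsubmx _) (rsubmx _) => x w E; exists w; apply/JF; exists x.
  by rewrite raddfB /= -E -mx11_scalar addrK.
- move=> v; rewrite -[v](@hsubmxK _ _ (frank F 0) (frank K 0)).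
  move: (lsubmx _) (rsubmx _) => x w; rewrite -(cone_exact exF0 phi0 JK) /=.
  rewrite mul_row_col; split=> [E|[]//]; split=> //; apply/JF; exists (- x).
  by rewrite -mx11_scalar mulNmx; apply/eqP; rewrite eq_sym -addr_eq0 addrC E.
move=> i v; rewrite -[v](@hsubmxK _ _ (frank F i.+1) (frank K i.+1)).
move: (lsubmx _) (rsubmx _) => x w; rewrite -(cone_exact (exF i) (phiS i) (exK i)) /=.
rewrite mul_row_block mulmx0 add0r mulmxN; split=> [E | [-> ->]]; last first.
  by rewrite oppr0 row_mx0.
have [] : x *m fdiff F i + w *m phi i = 0 /\ - (w *m fdiff K i) = 0.
  by apply: eq_row_mx; rewrite E row_mx0.
by move=> -> /eqP; rewrite oppr_eq0 => /eqP.
Qed.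

(** A nonzero constant entry forces the degrees of its row and column to agree. *)
Lemma homogmx_coeff0 r s (e : 'I_r -> 'X_{1..n}) (d : 'I_s -> 'X_{1..n})
    (A : 'M[R]_(r, s)) :
  homogmx e d A -> (forall i j, e i != d j) -> map_mx (mcoeff 0%MM) A = 0.
Proof.
move=> hA ned; apply/matrixP=> i j; rewrite !mxE; apply/memN_msupp_eq0/negP=> /hA.
by rewrite add0m => E; have := ned i j; rewrite E eqxx.
Qed.

Lemma ndeg_neq F K i j (l : 'I_(frank F i)) (l' : 'I_(frank K j)) :
  (forall a, (0 < ndeg K j a)%N -> ndeg F i a = 0%N) -> fdeg l' != fdeg l.
Proof.
move=> H; apply/eqP=> E; have /H : (0 < ndeg K j (fdeg l'))%N.
  by rewrite /ndeg (bigD1 l') //= eqxx.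
by rewrite /ndeg (bigD1 l) //= E eqxx.
Qed.

(** The comparison map is the only new part of the differential, and it goes
    from [K_(i+1)] to [F_i]: disjointness of their degrees keeps it minimal. *)
Lemma cone_minimal F K phi :
  (forall i, diff_k F i = 0) -> (forall i, diff_k K i = 0) ->
  (forall i, homogmx (@fdeg _ _ K i.+1) (@fdeg _ _ F i) (phi i)) ->
  (forall i a, (0 < ndeg K i.+1 a)%N -> ndeg F i a = 0%N) ->
  forall i, diff_k (@cone F K phi) i = 0.
Proof.
move=> mF mK hphi nKF i; rewrite /diff_k /= map_block_mx.
have -> : map_mx (mcoeff 0%MM) (phi i) = 0.
  by apply: homogmx_coeff0 (hphi i) _ => j l; apply: ndeg_neq (nKF i).
have -> : map_mx (mcoeff 0%MM) (- fdiff K i) = 0.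
  by rewrite map_mxN -/(diff_k K i) mK oppr0.
by rewrite -/(diff_k F i) mF map_mx0 block_mx0.
Qed.

Lemma resolution_aug J F j : graded_free_resolution J F -> J (faug F j 0).
Proof.
case=> _ JF _ _; apply/JF; exists (delta_mx 0 j); rewrite -rowE.
by apply/matrixP=> a b; rewrite !ord1 !mxE eqxx mulr1n.
Qed.

End MappingCone.

(** * Adding the pivot generator *)

Section PivotStep.
Variables (k : fieldType) (n : nat).
Local Notation R := {mpoly k[n]}.
Implicit Types (F K C : free_seq k n) (I J : R -> Prop) (H : seq 'X_{1..n}).

Lemma ideal_of_seq1 (m : 'X_{1..n}) (p : R) :
  ideal_of_seq [:: m] p <-> exists q, p = q * 'X_[m].
Proof.
rewrite ideal_of_seq_cons; split=> -[q].
  case=> -[_|c s E _]; last by have := E c (mem_head _ _).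
  by rewrite big_nil => /eqP; rewrite subr_eq0 => /eqP ->; exists q.
by move=> ->; exists q; rewrite subrr; exists [::]; rewrite ?big_nil.
Qed.

(** If [F] resolves the intersection of an ideal [J] with the ideal generated by
    [m], and [D] is the augmentation of [F] divided by [m], this is the
    resolution of [R / (J : m)], shifted to start in degree [m]. *)
Definition colon_seq F (m : 'X_{1..n}) (D : 'M[R]_(frank F 0, 1)) : free_seq k n :=
  let rk i := if i is i'.+1 then frank F i' else 1%N in
  @FreeSeq k n rk
    (fun i => match i return 'I_(rk i) -> 'X_{1..n} with
              | 0 => fun=> m | i'.+1 => @fdeg _ _ F i' end)
    (fun i => match i return 'M[R]_(rk i.+1, rk i) with
              | 0 => D | i'.+1 => fdiff F i' end)
    ('X_[m])%:M.

(** With [J] the ideal of [H], the exact sequence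
    [0 -> J \cap (m) -> J (+) (m) -> J + (m) -> 0] shifts the resolution of the
    intersection by one homological degree; the single shifted generator in
    degree 0 is the pivot itself. *)
Lemma pivot_resolution H (m : 'X_{1..n}) (L : R -> Prop) F G :
  graded_free_resolution (ideal_of_seq H) F -> graded_free_resolution L G ->
  (forall p, L p <-> ideal_of_seq H p /\ ideal_of_seq [:: m] p) ->
  ~~ has (fun g => (g <= m)%MM) H ->
  (forall i, diff_k F i = 0) -> (forall i, diff_k G i = 0) ->
  (forall i a, (0 < ndeg G i a)%N -> ndeg F i a = 0%N) ->
  exists C, [/\ graded_free_resolution (ideal_of_seq (m :: H)) C,
    forall i, diff_k C i = 0 &
    forall i a, ndeg C i a =
      (ndeg F i a + if i is i'.+1 then ndeg G i' a else a == m)%N].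
Proof.
move=> resF resG LE nHm minF minG nGF.
have [/homogeneousP[hG haG] LG exG0 exG] := resG.
have haX : homogmx (fun=> m) (fun=> 0%MM) (('X_[m] : R)%:M : 'M_1).
  by move=> i j u; rewrite !ord1 mxE eqxx mulr1n msuppX inE addm0 => /eqP.
have XI r (v : 'M[R]_(r, 1)) : v *m ('X_[m])%:M = 0 -> v = 0.
  move=> /eqP; rewrite mul_mx_scalar scalemx_eq0 => /orP[|/eqP//].
  by rewrite -msupp_eq0 msuppX.
have [|D hD ED] := homogmx_lift haX haG.
  move=> i; have /LE[_ /ideal_of_seq1[q Eq]] := resolution_aug i resG; exists q%:M.
  by apply/matrixP=> a b; rewrite mul_mx_scalar !ord1 !mxE eqxx mulr1n mulrC -Eq.
pose K := @colon_seq G m D.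
have hK : homogeneous K.
  by apply/homogeneousP; split=> [[|i]|]; [apply: hD | apply: hG | apply: haX].
have exK i (v : 'rV_(frank K i.+1)) :
    v *m fdiff K i = 0 <-> exists w, v = w *m fdiff K i.+1.
  case: i v => [|i] v; last exact: exG.
  apply: iff_trans (exG0 v); rewrite -ED mulmxA; split=> [-> | /XI//].
  by rewrite mul0mx.
have JK (v : 'rV_(frank K 0)) :
    ideal_of_seq H ((v *m faug K) 0 0) <-> exists w, v = w *m fdiff K 0.
  have Ev : (v *m faug K) 0 0 = v 0 0 * 'X_[m].
    by rewrite /= mul_mx_scalar mxE mulrC.
  have -> : ideal_of_seq H ((v *m faug K) 0 0) <-> L ((v *m faug K) 0 0).
    rewrite LE Ev; split=> [Hv|[]//]; split=> //.
    by apply/ideal_of_seq1; exists (v 0 0).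
  rewrite LG -mx11_scalar; split=> -[w E]; exists w.
    apply/eqP; rewrite -subr_eq0; apply/eqP/XI; rewrite mulmxBl -mulmxA ED E.
    exact: subrr.
  by rewrite -ED mulmxA E.
have [phi [hphi phi0 phiS]] :=
  comparison_map resF hK (fun v => (JK v).2) (fun i v => (exK i v).2).
exists (@cone _ _ F K phi); split.
- apply: cone_resolution resF hK JK exK _ hphi phi0 phiS => p.
  rewrite ideal_of_seq_cons; split=> [[q Hq] | [v Hv]].
    by exists q%:M; rewrite /= -scalar_mxM mxE eqxx mulr1n.
  by exists (v 0 0); move: Hv; rewrite /= mul_mx_scalar mxE mulrC.
- apply: cone_minimal minF _ hphi _ => [[|i]|i a]; last exact: nGF.
    (* A constant entry of [D] would put a multiple of [m] into the augmentation
       of [G], hence [m] into the ideal of [H]. *)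
    apply/matrixP=> j l; rewrite !mxE !ord1; apply/eqP; rewrite mcoeff_eq0.
    apply/negP=> D0; case/negP: nHm.
    have /LE[/ideal_of_seqP + _] := resolution_aug j resG; apply.
    rewrite -ED mul_mx_scalar mxE mulrC (perm_mem (msuppMX _ _)).
    by apply/mapP; exists 0%MM; rewrite ?addm0.
  exact: minG.
move=> [|i] a; rewrite ndeg_cone //; congr (_ + _)%N.
by rewrite /ndeg /= big_ord1 eq_sym.
Qed.

End PivotStep.

(** * The resolution supported by a Mayer-Vietoris tree *)

Section TreeResolution.
Variables (k : fieldType) (n : nat).
Local Notation R := {mpoly k[n]}.
Implicit Types (F : free_seq k n) (T : mvtree n) (a : 'X_{1..n}).

Definition mvt_gens T := match T with MVLeaf G => G | MVNode G _ _ => G end.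

(** The contribution to [mvt_betti] of the nodes other than the root. Every
    node in a left position is relevant and no other non-root node is, so
    positions need not be carried along. *)
Fixpoint nonroot_betti T i a : nat :=
  match T with
  | MVLeaf _ => 0%N
  | MVNode _ TL TR =>
      ((if i is i'.+1 then
          ((i' == 0%N) && (a \in mvt_gens TL)) + nonroot_betti TL i' a
        else 0) + nonroot_betti TR i a)%N
  end.

Lemma mvt_nodes_count p d T i a : (0 < p)%N ->
  count (fun x : nat * nat * seq 'X_{1..n} =>
           [&& relevant x.1.1, x.1.2 == i & a \in x.2]) (mvt_nodes p d T) =
  if (d <= i)%N then
    ([&& relevant p, i == d & a \in mvt_gens T] + nonroot_betti T (i - d) a)%N
  else 0%N.
Proof.
elim: T p d => [G|G TL IHL TR IHR] p d p_gt0 /=.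
  rewrite !addn0 [d == i]eq_sym; case: leqP => // lt_id.
  by rewrite ltn_eqF //= andbF.
rewrite count_cat IHL ?IHR ?muln_gt0 //.
have -> : relevant (2 * p) by rewrite /relevant mul2n odd_double orbT.
have -> : relevant (2 * p).+1 = false.
  by rewrite /relevant /= mul2n odd_double orbF eqSS double_eq0; case: p p_gt0.
rewrite /= [d == i]eq_sym add0n; case: (leqP d.+1 i) => [lt_di | ].
  rewrite (ltnW lt_di) subnS -(ltn_predK (_ : 0 < i - d)%N) ?subn_gt0 //=.
  congr (_ + (_ && _ + _ + _))%N.
  by lia.
rewrite ltnS leq_eqVlt => /predU1P[-> | lt_id]; first by rewrite leqnn subnn.
by rewrite leqNgt lt_id ltn_eqF //= andbF.
Qed.

Lemma mvt_bettiE T i a :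
  mvt_betti T i a = (((i == 0%N) && (a \in mvt_gens T)) + nonroot_betti T i a)%N.
Proof. by rewrite /mvt_betti mvt_nodes_count // subn0. Qed.

Lemma mvt_gensP (I : R -> Prop) T : is_mvt I T -> min_gens I (mvt_gens T).
Proof. by case: T => [G|G TL TR] []. Qed.

(** The same recursion as in [pivot_resolution]. The right child is not
    relevant, but its minimal generators together with the pivot are those of
    the parent, which is why it can be counted as a root. *)
Lemma mvt_betti_node (I : R -> Prop) G TL TR m i a :
  min_gens I G -> m \in G -> is_mvt (ideal_of_seq (rem m G) : R -> Prop) TR ->
  mvt_betti (MVNode G TL TR) i a =
  (mvt_betti TR i a + if i is i'.+1 then mvt_betti TL i' a else a == m)%N.
Proof.
move=> mG Gm /mvt_gensP mR; have [uG _ _] := mG.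
have Ra : (a \in mvt_gens TR) = (a != m) && (a \in G).
  suff -> : mvt_gens TR =i rem m G by rewrite mem_rem_uniq // inE.
  exact: min_gens_unique mR (min_gens_rem m mG).
rewrite !mvt_bettiE /=; case: i => [|i] /=; last first.
  by rewrite mvt_bettiE !add0n addnC.
by rewrite !add0n Ra; case: eqP => [->|_]; rewrite ?Gm /= ?addn0 // addnC.
Qed.

(** The condition is on equal homological degrees of the two children, not on
    consecutive ones in the whole tree: the latter can fail for stable ideals
    with generators of different degrees. *)
Fixpoint no_cancellation T : Prop :=
  match T with
  | MVLeaf _ => True
  | MVNode _ TL TR => [/\ no_cancellation TL, no_cancellation TR &
      forall i a, (0 < mvt_betti TL i a)%N -> mvt_betti TR i a = 0%N]
  end.

Lemma principal_resolution (m : 'X_{1..n}) :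
  exists F, [/\ graded_free_resolution (ideal_of_seq [:: m] : R -> Prop) F,
    forall i, diff_k F i = 0 &
    forall i a, ndeg F i a = ((i == 0) && (a == m))%N].
Proof.
pose rk i := if i is 0 then 1%N else 0%N.
exists (@FreeSeq k n rk (fun _ => fun=> m) (fun=> 0) ('X_[m])%:M); split.
- split=> [|p|v|i v] /=.
  + by split=> [i [] //|j u]; rewrite !ord1 mxE eqxx mulr1n msuppX inE => /eqP.
  + rewrite ideal_of_seq1; split=> [[q ->] | [v /matrixP/(_ 0 0)]].
      by exists q%:M; rewrite -scalar_mxM.
    by rewrite mul_mx_scalar !mxE eqxx mulr1n => <-; exists (v 0 0); rewrite mulrC.
  + rewrite mul_mx_scalar; split=> [/matrixP E | [w ->]]; last by rewrite mulmx0 scaler0.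
    exists 0; rewrite mul0mx; apply/matrixP=> i j.
    have /eqP := E i j; rewrite !mxE mulf_eq0 => /orP[|/eqP//].
    by rewrite -msupp_eq0 msuppX.
  split=> _; last by rewrite mulmx0.
  by exists 0; apply/matrixP=> ? [].
- by move=> i; apply/matrixP=> -[].
move=> [|i] a; rewrite /ndeg /= ?big_ord0 // big_ord1 eq_sym.
by case: eqP.
Qed.

(** By induction on the tree, gluing the resolutions of the two children with
    [pivot_resolution]. *)
Lemma mvt_resolution (I : R -> Prop) T : is_mvt I T -> no_cancellation T ->
  exists F, [/\ graded_free_resolution I F, forall i, diff_k F i = 0 &
    forall i a, ndeg F i a = mvt_betti T i a].
Proof.
have ext (J L : R -> Prop) F : (forall p, J p <-> L p) ->
    graded_free_resolution L F -> graded_free_resolution J F.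
  by move=> JL [hF LF e0 eS]; split=> // p; rewrite JL.
elim: T I => [G|G TL IHL TR IHR] I /=.
  case=> -[_ IG _]; case: G IG => [|m [|//]] //= IG _ _.
  have [F [resF minF nF]] := principal_resolution m.
  exists F; split=> //; first exact: ext resF.
  by move=> i a; rewrite nF mvt_bettiE /= addn0 inE.
case=> mG _ [m [Gm mvtL mvtR]] [ncL ncR nc].
have [F [resF minF nF]] := IHR _ mvtR ncR.
have [K [resK minK nK]] := IHL _ mvtL ncL.
have [||C [resC minC nC]] :=
  pivot_resolution resF resK (fun p => iff_refl _) _ minF minK _.
- by case: mG => _ _ /(_ m Gm); apply: contra_notN => ?; apply/ideal_of_seqX.
- by move=> i a; rewrite nK nF; apply: nc.
exists C; split=> //.
  apply: ext resC => p; case: mG => _ IG _; rewrite IG.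
  split; apply: ideal_of_seq_sub => g gG; apply/hasP; exists g; rewrite ?lepm_refl //.
    by rewrite -(perm_mem (perm_to_rem Gm)).
  by rewrite (perm_mem (perm_to_rem Gm)).
move=> i a; rewrite nC nF (mvt_betti_node _ _ _ mG Gm mvtR).
by case: i => // i; rewrite nK.
Qed.

(** * Reading Tor off a minimal resolution *)

Lemma rank_diag_bool r (b : 'I_r -> bool) :
  \rank (diag_mx (\row_j ((b j)%:R : k))) = (\sum_j b j)%N.
Proof.
elim: r b => [|r IHr] b.
  by rewrite big_ord0; apply/eqP; rewrite -leqn0 rank_leq_row.
rewrite big_ord_recl -(IHr (fun j => b (lift ord0 j))).
pose d : 'rV[k]_(1 + r) := \row_j (b j)%:R.
transitivity (\rank (diag_mx (lsubmx d)) + \rank (diag_mx (rsubmx d)))%N.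
  by rewrite -rank_diag_block_mx -diag_mx_row hsubmxK.
congr (_ + _)%N; last first.
  congr (\rank (diag_mx _)); apply/rowP=> j; rewrite !mxE.
  by congr ((b _)%:R); apply: val_inj.
have -> : diag_mx (lsubmx d) = (b ord0)%:R%:M.
  apply/matrixP=> i j; rewrite !ord1 !mxE eqxx.
  by congr ((b _)%:R *+ _); apply: val_inj.
by case: (b ord0); rewrite ?mxrank1 // raddf0 mxrank0.
Qed.

(** Tensored with the residue field, all differentials vanish: everything is a
    cycle and nothing is a boundary. *)
Lemma minimal_tor_dim F i a : (forall i, diff_k F i = 0) -> tor_dim F i a = ndeg F i a.
Proof.
move=> minF; rewrite /tor_dim minF mulmx0 mxrank0 subn0.
have -> : \rank (cycles_k F i :&: strand F i a)%MS = \rank (strand F i a).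
  apply: eqmx_rank; rewrite capmxSr sub_capmx submx_refl andbT.
  case: i => [|i] /=; first exact: submx1.
  by rewrite minF kermx0 submx1.
exact: rank_diag_bool.
Qed.

Lemma no_cancellation_type_B2 (I : R -> Prop) T :
  is_mvt I T -> no_cancellation T -> MV_type_B2 I.
Proof.
move=> mvtT ncT; have [F [resF minF nF]] := mvt_resolution mvtT ncT.
by exists T => // i a; exists F; rewrite ?minimal_tor_dim.
Qed.

End TreeResolution.

(** * Trees for ideals generated by multiples of variables *)

Section StableTrees.
Variables (k : fieldType) (n : nat).
Local Notation R := {mpoly k[n]}.
Local Notation ideal G := (@ideal_of_seq k n G).
Implicit Types (T : mvtree n) (G H : seq 'X_{1..n}) (a u v m g h : 'X_{1..n}).

Definition multiples G u := has (fun g => (g <= u)%MM) G.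

Lemma multiplesP G u : reflect (exists2 g, g \in G & (g <= u)%MM) (multiples G u).
Proof. exact: hasP. Qed.

(** Generates [m] times the ideal of the first [r] variables, which the Koszul
    complex resolves. *)
Definition koszul_gens m r : seq 'X_{1..n} :=
  [seq (m + U_(i))%MM | i : 'I_n <- enum 'I_n & (i < r)%N].

Lemma koszul_gensP m r u :
  reflect (exists2 i : 'I_n, (i < r)%N & u = (m + U_(i))%MM) (u \in koszul_gens m r).
Proof.
apply: (iffP mapP) => [[i] | [i ir ->]].
  by rewrite mem_filter => /andP[ir _] ->; exists i.
by exists i; rewrite // mem_filter ir mem_enum.
Qed.

Lemma size_koszul_gens m r : (r <= n)%N -> size (koszul_gens m r) = r.
Proof.
move=> le_rn; rewrite size_map size_filter.
rewrite (eq_count (a2 := preim val (fun j => (j < 0 + r)%N))) //.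
rewrite -count_map val_enum_ord.
by rewrite -size_filter filter_iota_ltn // size_iota.
Qed.

Lemma min_gens_koszul m r : min_gens (ideal (koszul_gens m r)) (koszul_gens m r).
Proof.
apply/min_gensP; split=> //.
  rewrite map_inj_uniq => [|i j /addmI/eqP]; last by rewrite eq_mnm1 => /eqP.
  exact/filter_uniq/enum_uniq.
apply/antichainP=> h g /koszul_gensP[i _ ->] /koszul_gensP[j _ ->].
move=> /mnm_lepP/(_ i); rewrite !mnmDE !mnm1E eqxx leq_add2l.
by case: eqP => // ->.
Qed.

(** The two hypotheses say that the colon ideal of [G] by [m] is contained in,
    and contains, the ideal of the first [r] variables. *)
Lemma colon_koszul G m r :
  (forall g, g \in G -> exists2 i : 'I_n, (i < r)%N & (m i < g i)%N) ->
  (forall i : 'I_n, (i < r)%N -> multiples G (m + U_(i))) ->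
  forall p, ideal (koszul_gens m r) p <-> ideal G p /\ ideal [:: m] p.
Proof.
move=> gt_m Gm p; rewrite ideal_of_seqI; split; apply: ideal_of_seq_sub => g.
  case/koszul_gensP=> i /Gm/multiplesP[h hG hm] ->.
  apply/hasP; exists (mlcm h m); first by apply/mapP; exists h.
  by rewrite lem_mlcm hm lem_addr.
case/mapP=> h /gt_m[i ir mh] ->; apply/hasP; exists (m + U_(i))%MM.
  by apply/koszul_gensP; exists i.
apply/mnm_lepP=> j; rewrite mnmDE mnm1E mnmE; case: eqP => [<-|_]; last by lia.
by lia.
Qed.

Lemma mvt_node (I : R -> Prop) G m r TL TR :
  min_gens I G -> m \in G -> (2 <= size G)%N ->
  (forall g, g \in rem m G -> exists2 i : 'I_n, (i < r)%N & (m i < g i)%N) ->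
  (forall i : 'I_n, (i < r)%N -> multiples (rem m G) (m + U_(i))) ->
  is_mvt (ideal (koszul_gens m r)) TL -> is_mvt (ideal (rem m G)) TR ->
  is_mvt I (MVNode G TL TR).
Proof.
move=> mG Gm sG gt_m mGm mvtL mvtR; split=> //; exists m; split=> //.
exact: is_mvt_ext (colon_koszul gt_m mGm) mvtL.
Qed.

Lemma mem_rem_koszul m (x : 'I_n) :
  rem (m + U_(x))%MM (koszul_gens m x.+1) =i koszul_gens m x.
Proof.
have [uK _ _] := min_gens_koszul m x.+1.
move=> u; rewrite mem_rem_uniq // inE; apply/andP/koszul_gensP.
  case=> nu /koszul_gensP[i]; rewrite ltnS leq_eqVlt.
  case/predU1P=> [/val_inj-> E|]; last by exists i.
  by rewrite E /= eqxx in nu.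
case=> i ix ->; split; last by apply/koszul_gensP; exists i => //; apply: ltnW.
by rewrite /= eqm_add2l eq_mnm1 -val_eqE neq_ltn ix.
Qed.

Lemma ideal_of_seq_mem G H : G =i H -> forall p, ideal G p <-> ideal H p.
Proof.
by move=> GH p; split; apply: ideal_of_seq_sub => g gG; apply/hasP; exists g;
   rewrite ?lepm_refl // ?GH // -GH.
Qed.

(** Take the multiple of the last variable as pivot at each node: both children
    are then of the same form, with one variable less. The generators of the
    left child have one degree more than those of the right child, so the degree
    is an affine function of the dimension and no cancellation can occur. *)
Lemma koszul_tree m r : (0 < r <= n)%N -> exists T,
  [/\ is_mvt (ideal (koszul_gens m r)) T, no_cancellation T &
    forall i a, (0 < mvt_betti T i a)%N -> mdeg a = (mdeg m + i.+1)%N].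
Proof.
elim: r m => // -[|r] IHr m /andP[_ le_rn].
  exists (MVLeaf (koszul_gens m 1)); split=> //=.
    by split; [apply: min_gens_koszul | apply: size_koszul_gens].
  move=> i a; rewrite mvt_bettiE /= addn0 lt0b => /andP[/eqP-> /koszul_gensP[j _ ->]].
  by rewrite mdegD mdeg1.
pose x := Ordinal le_rn; pose q := (m + U_(x))%MM.
have [|TL [mvtL ncL degL]] := IHr q; first exact: ltnW.
have [|TR [mvtR ncR degR]] := IHr m; first exact: ltnW.
have Kq : q \in koszul_gens m x.+1 by apply/koszul_gensP; exists x.
have {}mvtR : is_mvt (ideal (rem q (koszul_gens m x.+1))) TR.
  by apply: is_mvt_ext mvtR; apply: ideal_of_seq_mem => u; rewrite mem_rem_koszul.
exists (MVNode (koszul_gens m x.+1) TL TR); split.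
- apply: (mvt_node (min_gens_koszul _ _) Kq _ _ _ mvtL mvtR).
  + by rewrite size_koszul_gens.
  + move=> g; rewrite mem_rem_koszul => /koszul_gensP[i ix ->]; exists i => //.
    by rewrite /q !mnmDE !mnm1E eqxx -val_eqE gtn_eqF // addn0 addn1.
  move=> i ix; apply/multiplesP; exists (m + U_(i))%MM.
    by rewrite mem_rem_koszul; apply/koszul_gensP; exists i.
  by apply/mnm_lepP=> j; rewrite !mnmDE; lia.
- split=> // i a /degL dL; apply/eqP; rewrite -leqn0 leqNgt; apply/negP=> /degR.
  by rewrite dL mdegD mdeg1; lia.
move=> i a; rewrite (mvt_betti_node _ _ _ (min_gens_koszul m x.+1) Kq mvtR) addn_gt0.
case/orP=> [/degR //|]; case: i => [|i].
  by rewrite lt0b => /eqP ->; rewrite mdegD mdeg1.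
by move=> /degL ->; rewrite mdegD mdeg1; lia.
Qed.

(** * Trees for stable ideals *)

Lemma max_index_exists u (l : 'I_n) : (0 < u l)%N ->
  exists2 j, is_max_index u j & (l <= j)%N.
Proof.
move=> ul; case: (@arg_maxnP _ l (fun i => (0 < u i)%N) val ul) => j uj jmax.
exists j; last exact: jmax.
split=> // i ji; apply/eqP; rewrite -leqn0 leqNgt; apply/negP=> /jmax.
by rewrite /geq /= leqNgt ji.
Qed.

Definition stable_gens G := forall u (i j : 'I_n),
  multiples G u -> is_max_index u j -> (i < j)%N ->
  multiples G (u - U_(j) + U_(i)).

Lemma mnm_moveE u (i j l : 'I_n) :
  (u - U_(j) + U_(i))%MM l = (u l - (j == l) + (i == l))%N.
Proof. by rewrite mnmDE mnmBE !mnm1E. Qed.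

(** As long as [g] does not divide [m], it exceeds [m] at some index [l >= M],
    and by the degree hypothesis falls short of [m] at some [i]; since [m]
    vanishes beyond [M], this [i] is below the maximal index of [g]. Stability
    allows moving one unit of [g] from its maximal index to [i], which lowers
    the weight, so the process stops. *)
Lemma multiples_exchange G g m (M : 'I_n) :
  stable_gens G -> multiples G g -> is_max_index m M ->
  (forall t : 'I_n, (t < M)%N -> (g t <= m t)%N) -> (mdeg g <= mdeg m)%N ->
  exists g', [/\ multiples G g', (g' <= m)%MM, mdeg g' = mdeg g &
    g' = g \/ (mnmwgt g' < mnmwgt g)%N].
Proof.
move=> stG Gg [mM mM0] le_gm deg_gm.
have [d] := ubnP (mnmwgt g); elim: d g Gg le_gm deg_gm => // d IHd g Gg le_gm deg_gm wd.
case: (boolP (g <= m)%MM) => [|/forallPn[l]]; first by exists g; split=> //; left.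
rewrite -ltnNge => mg_l.
have Ml : (M <= l)%N by rewrite leqNgt; apply/negP=> /le_gm; lia.
have [|N [gN gN0] lN] := @max_index_exists g l; first exact: leq_ltn_trans mg_l.
have [i gm_i] : exists i : 'I_n, (g i < m i)%N.
  apply/existsP; rewrite -[[exists i, _]]negbK; apply/negP=> /existsPn no.
  suff : (mdeg m < mdeg g)%N by lia.
  rewrite !mdegE (bigD1 l) // [X in (_ < X)%N](bigD1 l) //= -addSn leq_add //.
  by apply: leq_sum => j _; have := no j; rewrite -leqNgt.
have iM : (i <= M)%N by rewrite leqNgt; apply/negP=> /mM0; lia.
have iN : (i < N)%N.
  have : (i : nat) != l by apply: contraTneq gm_i => /val_inj ->; lia.
  by lia.
have gNU : (U_(N) <= g)%MM by rewrite lep1mP -lt0n.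
pose g2 := (g - U_(N) + U_(i))%MM.
have deg2 : mdeg g2 = mdeg g.
  by rewrite mdegD -{2}(submK gNU) mdegD !mdeg1.
have wgt2 : (mnmwgt g2 < mnmwgt g)%N.
  by rewrite mnmwgtD -{2}(submK gNU) mnmwgtD !mnmwgt1; lia.
have [|t tM|||g' [Gg' g'm degg' wg']] := IHd g2.
- exact: (stG _ _ N Gg).
- by rewrite mnm_moveE; have := le_gm t tM; case: (i =P t) gm_i => [->|_]; lia.
- by rewrite deg2.
- exact: leq_trans wgt2 wd.
exists g'; split; rewrite ?degg' //; right.
by case: wg' => [->|] //; lia.
Qed.

(** The weight [mnmwgt] orders monomials of equal degree by how late their
    variables come, which is all of the reverse lexicographic order that the
    exchange argument can see. *)
Definition revlex_pivot G m := m \in G /\ forall g, g \in G ->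
  (mdeg g <= mdeg m)%N /\ (mdeg g = mdeg m -> (mnmwgt g <= mnmwgt m)%N).

Lemma pivot_exists G : (0 < size G)%N -> exists m, revlex_pivot G m.
Proof.
elim: G => // x [|y G] IHG _.
  by exists x; split=> [|g]; rewrite inE // => /eqP->.
have [m [mG mP]] := IHG isT.
have [le_xm|nle] := boolP ((mdeg x < mdeg m)%N ||
  (mdeg x == mdeg m) && (mnmwgt x <= mnmwgt m)%N).
  exists m; split; first by rewrite inE mG orbT.
  by move=> g; rewrite inE => /predU1P[->|/mP//]; lia.
exists x; split; first exact: mem_head.
move=> g; rewrite inE => /predU1P[->|/mP[]]; lia.
Qed.

(** Otherwise [multiples_exchange] would turn [g] into a divisor of [m] in the
    ideal, that is into [m] by minimality: [g] has then the same degree as [m],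
    and a larger weight, against the choice of [m]. *)
Lemma pivot_exceeded G m (M : 'I_n) g :
  uniq G -> antichain G -> stable_gens G -> revlex_pivot G m -> is_max_index m M ->
  g \in rem m G -> exists2 t : 'I_n, (t < M)%N & (m t < g t)%N.
Proof.
move=> uG aG stG [mG mP] maxM; rewrite mem_rem_uniq // !inE => /andP[ngm gG].
have [deg_g wgt_g] := mP g gG.
suff /existsP[t /andP[]] : [exists t : 'I_n, (t < M)%N && (m t < g t)%N] by exists t.
rewrite -[[exists t, _]]negbK; apply/negP=> /existsPn no.
have [|t tM|g' [/multiplesP[h hG hg'] g'm degg' wg']] :=
  multiples_exchange stG _ maxM _ deg_g.
- by apply/multiplesP; exists g => //; apply: lepm_refl.
- by have := no t; rewrite tM -leqNgt.
have hm : h = m by apply: (antichainP _ aG) => //; apply: lepm_trans hg' g'm.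
have E : g' = m by apply: lepm_anti; rewrite -?hm // hm.
case: wg' => [E'|]; first by rewrite -E' E eqxx in ngm.
by rewrite E ltnNge wgt_g // -degg' E.
Qed.

(** Stability applied to [m] itself puts [x_i m / x_M] into the ideal, and the
    generator below it cannot be [m], whose exponent at [M] is too large. *)
Lemma pivot_covered G m (M i : 'I_n) :
  uniq G -> stable_gens G -> m \in G -> is_max_index m M ->
  (i < M)%N -> multiples (rem m G) (m + U_(i)).
Proof.
move=> uG stG mG maxM iM; have Gm : multiples G m.
  by apply/multiplesP; exists m => //; apply: lepm_refl.
have /multiplesP[h hG hm] := stG _ _ _ Gm maxM iM.
apply/multiplesP; exists h.
  rewrite mem_rem_uniq // !inE hG andbT; apply: contraTneq hm => ->.
  apply/mnm_lepP=> /(_ M); rewrite mnm_moveE eqxx -val_eqE (ltn_eqF iM).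
  by case: maxM => mM _; lia.
by apply/mnm_lepP=> j; have := mnm_lepP hm j; rewrite mnm_moveE mnmDE mnm1E; lia.
Qed.

(** A stable move that leads from the ideal [J] of the other generators out of
    [J] must end at [m] times a monomial in the variables from [M] on, by
    [pivot_covered]. The exponent exceeding [m] at [t < M] given by
    [pivot_exceeded] would then have to be the one lowered by the move, so that
    [N = t < M] would be maximal, although [x_M] divides the result and hence
    the source of the move. *)
Lemma stable_gens_rem G m (M : 'I_n) :
  uniq G -> antichain G -> stable_gens G -> revlex_pivot G m -> is_max_index m M ->
  stable_gens (rem m G).
Proof.
move=> uG aG stG pm maxM u i N /multiplesP[g gG' gu] maxN iN.
have [t tM mg_t] := pivot_exceeded uG aG stG pm maxM gG'.
have Gu : multiples G u.
  by apply/multiplesP; exists g => //; apply: mem_rem gG'.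
have /multiplesP[h hG hv] := stG _ _ _ Gu maxN iN.
case: (eqVneq h m) => [hm | nhm]; last first.
  by apply/multiplesP; exists h; rewrite // mem_rem_uniq // !inE nhm.
rewrite {}hm in hv.
case: (boolP [exists s : 'I_n, (s < M)%N && (m s < (u - U_(N) + U_(i))%MM s)%N]).
  case/existsP=> s /andP[/(pivot_covered uG stG pm.1 maxM)/multiplesP[h' h'G h'm] ms].
  apply/multiplesP; exists h' => //; apply: lepm_trans h'm _.
  apply/mnm_lepP=> j; rewrite mnmDE mnm1E; have := mnm_lepP hv j.
  by case: (s =P j) => [<-|_] //; rewrite ?addn0 // addn1.
move=> /existsPn/(_ t); rewrite tM -leqNgt /= mnm_moveE => ut.
have := leq_trans mg_t (mnm_lepP gu t) => mu_t.
have tN : N = t by apply/eqP; case: eqP ut => //; lia.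
case: maxM maxN => mM _ [_ uN].
have iM : (i == M) = false.
  by apply/negbTE; rewrite -val_eqE ltn_eqF // (ltn_trans iN) ?tN.
by have := mnm_lepP hv M; rewrite mnm_moveE uN ?tN // iM; lia.
Qed.

(** Splitting off the pivot repeatedly leaves stable ideals all along the right
    spine. At each node the right subtree lives in degrees at most
    [mdeg m + i], the left one in degree [mdeg m + i + 1]. *)
Lemma stable_tree G : uniq G -> antichain G -> stable_gens G -> (0 < size G)%N ->
  exists T, [/\ is_mvt (ideal G) T, no_cancellation T &
    forall i a, (0 < mvt_betti T i a)%N ->
      exists2 g, g \in G & (mdeg a <= mdeg g + i)%N].
Proof.
have [d] := ubnP (size G); elim: d G => // d IHd G sGd uG aG stG sG0.
have mgG : min_gens (ideal G) G by apply/min_gensP.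
case: (ltnP 1 (size G)) => [sG | sG1]; last first.
  exists (MVLeaf G); split=> //=; first by split=> //; lia.
  move=> i a; rewrite mvt_bettiE /= addn0 lt0b => /andP[_ aG'].
  by exists a; rewrite // leq_addr.
have [m pm] := pivot_exists sG0; have [mG mP] := pm.
have srem : size (rem m G) = (size G).-1 by rewrite size_rem.
have [g0 g0G] : exists g, g \in rem m G.
  by case: (rem m G) srem => [|g s] /= E; [lia | exists g; apply: mem_head].
have [l ml] : exists l : 'I_n, (0 < m l)%N.
  apply/existsP; rewrite -[[exists i, _]]negbK; apply/negP=> /existsPn m0.
  move: g0G; rewrite mem_rem_uniq // !inE => /andP[/eqP ne g0G]; apply: ne.
  apply/esym/(antichainP _ aG) => //; apply/mnm_lepP=> i.
  by have := m0 i; rewrite -eqn0Ngt => /eqP->.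
have [M maxM _] := max_index_exists ml.
have exc g := @pivot_exceeded G m M g uG aG stG pm maxM.
have cov i := @pivot_covered G m M i uG stG mG maxM.
have M0 : (0 < M)%N by have [t tM _] := exc _ g0G; lia.
have [|TL [mvtL ncL degL]] := @koszul_tree m M; first by rewrite M0 ltnW.
have [|||||TR [mvtR ncR degR]] := IHd (rem m G).
- by rewrite srem; lia.
- exact: rem_uniq.
- by have [_ _ ] := (min_gensP _ _).1 (min_gens_rem m mgG).
- exact: (stable_gens_rem uG aG stG pm maxM).
- by rewrite srem; lia.
exists (MVNode G TL TR); split.
- exact: mvt_node mgG mG sG exc cov mvtL mvtR.
- split=> // i a /degL dL; apply/eqP; rewrite -leqn0 leqNgt.
  apply/negP=> /degR[g /mem_rem gG].
  by have [] := mP g gG; rewrite dL; lia.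
move=> i a; rewrite (mvt_betti_node _ _ _ mgG mG mvtR) addn_gt0.
case/orP=> [/degR[g /mem_rem gG]|]; first by exists g.
case: i => [|i]; first by rewrite lt0b => /eqP ->; exists m; rewrite ?addn0.
by move=> /degL ->; exists m.
Qed.

End StableTrees.

Theorem proposition4p1p5 (k : fieldType) (n : nat)
    (I : {mpoly k[n]} -> Prop) :
  [pchar k] =i pred0 -> monomial_ideal I -> stable I -> MV_type_B2 I.
Proof.
move=> _ monI stI; have [G mgG G0] := monomial_ideal_min_gens monI.
have [uG IG aG] := (min_gensP _ _).1 mgG.
have memI u : I 'X_[u] <-> multiples G u by rewrite IG; apply: ideal_of_seqX.
have stG : stable_gens G.
  by move=> u i j /memI Iu maxj ij; apply/memI; apply: stI.
have [T [mvtT ncT _]] := stable_tree k uG aG stG G0.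
by apply: no_cancellation_type_B2 ncT; apply: is_mvt_ext mvtT => p; apply: iff_sym.
Qed.
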